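(* Let $X$ be a real Hilbert space and let $A:X\rightrightarrows X$ and $B:X\rightrightarrows X$ be maximally monotone operators. Then $R_A$ is an isometric bijection from $\operatorname{Fix} T_{A,B}$ to $\operatorname{Fix} T_{B,A}$, with isometric inverse $R_B:\operatorname{Fix} T_{B,A}\to\operatorname{Fix} T_{A,B}$. Moreover, the diagram with vertices $\operatorname{Fix} T_{A,B}$, $\operatorname{Fix} T_{B,A}$, $\mathcal{S}_{(A,B)}$, $\mathcal{S}_{(B,A)}$ and with the following arrows is (well defined and) commutative, meaning that any two directed paths with the same start and the same end give the same map (so that, in particular, opposite arrows are mutually inverse): \begin{itemize} \item $R_A:\operatorname{Fix} T_{A,B}\to\operatorname{Fix} T_{B,A}$ and $R_B:\operatorname{Fix} T_{B,A}\to\operatorname{Fix} T_{A,B}$; \item $\operatorname{Id}\times(-\operatorname{Id}):\mathcal{S}_{(A,B)}\to\mathcal{S}_{(B,A)}$, $(z,w)\mapsto(z,-w)$, and likewise $\operatorname{Id}\times(-\operatorname{Id}):\mathcal{S}_{(B,A)}\to\mathcal{S}_{(A,B)}$; \item $(J_A,\operatorname{Id}-J_A)\circ\Delta:\operatorname{Fix} T_{A,B}\to\mathcal{S}_{(A,B)}$, $x\mapsto(J_Ax,\,x-J_Ax)$, and $+:\mathcal{S}_{(A,B)}\to\operatorname{Fix} T_{A,B}$, $(z,w)\mapsto z+w$; \item $(J_B,\operatorname{Id}-J_B)\circ\Delta:\operatorname{Fix} T_{B,A}\to\mathcal{S}_{(B,A)}$, $x\mapsto(J_Bx,\,x-J_Bx)$,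 and $+:\mathcal{S}_{(B,A)}\to\operatorname{Fix} T_{B,A}$, $(z,w)\mapsto z+w$. \end{itemize} In particular, $R_A:\operatorname{Fix} T_{A,B}\to\operatorname{Fix} T_{B,A}$ is given by $z+k\mapsto z-k$, where $(z,k)\in\mathcal{S}_{(A,B)}$.
   Context: $\operatorname{Id}$ is the identity on $X$. For a maximally monotone operator $A$, $J_A=(\operatorname{Id}+A)^{-1}$ is the resolvent (single-valued, defined on all of $X$) and $R_A=2J_A-\operatorname{Id}$ is the reflected resolvent. The Douglas--Rachford operator of the ordered pair $(A,B)$ is $T_{A,B}=\tfrac12(\operatorname{Id}+R_BR_A)=\operatorname{Id}-J_A+J_BR_A$; correspondingly $T_{B,A}=\tfrac12(\operatorname{Id}+R_AR_B)$. $\operatorname{Fix} T=\{x\in X: x=Tx\}$. The extended solution set of the pair $(A,B)$ is $\mathcal{S}_{(A,B)}=\{(z,w)\in X\times X : -w\in Bz,\ w\in Az\}$; thus $\mathcal{S}_{(B,A)}=\{(z,w)\in X\times X : -w\in Az,\ w\in Bz\}$. $\Delta:X\to X\times X$, $x\mapsto(x,x)$. A map $Q:C\to D$ between subsets of $X$ is an isometry if $\|Qx-Qy\|=\|x-y\|$ for all $x,y\in C$. *)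

(* Defs.v *)
From HB Require Import structures.
From mathcomp Require Import all_boot all_order all_algebra.
From mathcomp Require Import all_classical all_reals all_analysis.
Import numFieldNormedType.Exports.

Set Implicit Arguments.
Unset Strict Implicit.
Unset Printing Implicit Defensive.
Import Order.TTheory GRing.Theory Num.Theory.

Local Open Scope classical_set_scope.
Local Open Scope ring_scope.

(* A real Hilbert space is a complete normed module [X] over a real type [R]
   together with a symmetric positive definite bilinear form
   [dot : {dot X for idfun}] such that [norm_from_dot dot]. *)
Definition norm_from_dot (R : realType) (X : normedModType R)
    (dot : {dot X for idfun}) : Prop :=
  forall x : X, `|x| ^+ 2 = dot x x.

Definition isometric_on (R : realType) (X : normedModType R)
    (C : set X) (Q : X -> X) : Prop :=
  {in C &, forall x y, `|Q x - Q y| = `|x - y|}.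

(* A set-valued operator is a function [A : X -> set X]; [A x u] reads
   "u belongs to A x". *)
Section Monotone.
Context (R : realType) (X : lmodType R) (dot : {dot X for idfun}).
Implicit Types A : X -> set X.

Definition monotone A : Prop :=
  forall x y u v : X, A x u -> A y v -> 0 <= dot (x - y) (u - v).

Definition maximally_monotone A : Prop :=
  monotone A /\
  forall A', monotone A' ->
    (forall x, A x `<=` A' x) -> forall x, A' x `<=` A x.

End Monotone.

Section DouglasRachford.
Context (R : realType) (X : lmodType R).
Implicit Types (A B : X -> set X) (x : X).

Definition id_plus A : X -> set X := fun x => [set x + u | u in A x].

Definition op_inverse A : X -> set X := fun y => [set x | A x y].

(* [op_inverse (id_plus A)] is the set-valued operator (Id + A)^-1. When [A]
   is maximally monotone on a Hilbert space, Minty's theorem says that its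
   values are singletons, so the default value 0 of [xget] is not used. *)
Definition resolvent A : X -> X := fun x => xget 0 (op_inverse (id_plus A) x).

Definition reflected_resolvent A : X -> X :=
  fun x => 2%:R *: resolvent A x - x.

Definition DR_operator A B : X -> X := fun x =>
  2%:R^-1 *: (x + reflected_resolvent B (reflected_resolvent A x)).

Definition Fix (T : X -> X) : set X := [set x | x = T x].

Definition ext_solutions A B : set (X * X) :=
  [set zw | B zw.1 (- zw.2) /\ A zw.1 zw.2].

End DouglasRachford.

Inductive vertex : Set := FixAB | FixBA | SolAB | SolBA.

Inductive arrow : vertex -> vertex -> Set :=
| arrow_RA : arrow FixAB FixBA
| arrow_RB : arrow FixBA FixAB
| arrow_negAB : arrow SolAB SolBA
| arrow_negBA : arrow SolBA SolAB
| arrow_JA : arrow FixAB SolAB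
| arrow_addAB : arrow SolAB FixAB
| arrow_JB : arrow FixBA SolBA
| arrow_addBA : arrow SolBA FixBA.

(* Directed paths, including the empty path at each vertex; the empty paths
   make commutativity say that opposite arrows are mutually inverse. *)
Inductive dpath : vertex -> vertex -> Set :=
| dpath_nil v : dpath v v
| dpath_cons u v w : arrow u v -> dpath v w -> dpath u w.

Section Diagram.
Context (R : realType) (X : lmodType R) (A B : X -> set X).

Definition ambient (v : vertex) : Type :=
  match v with
  | FixAB | FixBA => X
  | SolAB | SolBA => (X * X)%type
  end.

Definition vertex_set (v : vertex) : set (ambient v) :=
  match v return set (ambient v) with
  | FixAB => Fix (DR_operator A B)
  | FixBA => Fix (DR_operator B A)
  | SolAB => ext_solutions A B
  | SolBA => ext_solutions B A
  end.
Arguments vertex_set : clear implicits.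

Definition arrow_map u v (a : arrow u v) : ambient u -> ambient v :=
  match a in arrow u v return ambient u -> ambient v with
  | arrow_RA => reflected_resolvent A
  | arrow_RB => reflected_resolvent B
  | arrow_negAB => fun zw : X * X => (zw.1, - zw.2)
  | arrow_negBA => fun zw : X * X => (zw.1, - zw.2)
  | arrow_JA => fun x : X => (resolvent A x, x - resolvent A x)
  | arrow_addAB => fun zw : X * X => zw.1 + zw.2
  | arrow_JB => fun x : X => (resolvent B x, x - resolvent B x)
  | arrow_addBA => fun zw : X * X => zw.1 + zw.2
  end.

Fixpoint dpath_map u v (p : dpath u v) : ambient u -> ambient v :=
  match p in dpath u v return ambient u -> ambient v with
  | dpath_nil _ => fun x => x
  | dpath_cons _ _ _ a q => fun x => dpath_map q (arrow_map a x)
  end.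

Definition diagram_well_defined : Prop :=
  forall u v (a : arrow u v),
    set_fun (vertex_set u) (vertex_set v) (arrow_map a).

Definition diagram_commutes : Prop :=
  forall u v (p q : dpath u v) (x : ambient u),
    vertex_set u x -> dpath_map p x = dpath_map q x.

End Diagram.

(* Main.v *)
Require Import Defs.
From HB Require Import structures.
From mathcomp Require Import all_boot all_order all_algebra.
From mathcomp Require Import all_classical all_reals all_analysis.
From mathcomp Require Import ring lra.
Set Implicit Arguments.
Unset Strict Implicit.
Unset Printing Implicit Defensive.
Import numFieldNormedType.Exports.
Import Order.TTheory GRing.Theory Num.Theory.
Local Open Scope classical_set_scope.
Local Open Scope ring_scope.

(** Everything rests on Minty's theorem: for a maximally monotone A, the resolvent
    J_A is everywhere defined, that is, every b splits as z + k with k in A z;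
    monotonicity makes the splitting unique, so J_A (z + k) = z and
    R_A (z + k) = z - k for every k in A z.

    Given this, a pair (z, k) in S_(A,B) has k in A z and -k in B z, so R_A
    sends z + k to z - k and R_B sends z - k back to z + k. Conversely the
    decomposition x = J_A x + (x - J_A x) of a fixed point of T_(A,B) is such a
    pair. Hence each of the four sets of the diagram is the image of S_(A,B)
    under an explicit formula ([vertex_point]: z + k, z - k, (z, k), (z, -k)),
    and each arrow maps the point that (z, k) has at its source to the point
    that (z, k) has at its target ([arrow_vertex_point]). So a directed path
    sends the point of (z, k) at its start to the point of (z, k) at its end,
    whichever way it goes: the diagram commutes. Bijectivity of R_A and R_B is
    commutativity along the paths of length two.

    The isometry is an orthogonality: for two pairs in S_(A,B), monotonicity
    of A gives <z - z', k - k'> >= 0 and that of B gives <= 0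
    ([ext_solutions_orthogonal]), so (z - z') + (k - k') and
    (z - z') - (k - k') have the same norm.

    Minty's theorem is proved by minimising a strongly convex function on
    X x X. With F_A the Fitzpatrick function, the supremum of
    <x, v> + <y, w> - <y, v> over the graph points (y, v) of A, let
      G (x, w) = |x + w - b|^2 + 2 (F_A (x, w) - <x, w>).
    Maximality gives G >= |x + w - b|^2 everywhere ([gap_le_ge]), with equality
    on the graph of A ([gap_le_graph]). Moreover G is a supremum of functions
    |(x, w) - p|^2 - const, hence strongly convex, so by completeness it has a
    minimiser (x, w) ([gap_minimizer]) and grows quadratically away from it
    ([gap_growth]). Comparing G at the minimiser with G on the graph shows that
    (b - w, b - x) is monotonically related to A, so it lies in the graph; the
    same inequality at that very point then forces x + w = b. *)

(** * Inner product identities *)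

Section Dot.
Context (R : realType) (X : lmodType R) (dot : {dot X for idfun}).
Implicit Types (x y z : X).

Lemma dotC x y : dot x y = dot y x.
Proof. by rewrite hermC /= expr0 mul1r. Qed.

Lemma dotDl x y z : dot (x + y) z = dot x z + dot y z.
Proof. exact: linearDl. Qed.

Lemma dotDr x y z : dot z (x + y) = dot z x + dot z y.
Proof. exact: linearDr. Qed.

Lemma dotNl x z : dot (- x) z = - dot x z.
Proof. exact: linearNl. Qed.

Lemma dotNr x z : dot z (- x) = - dot z x.
Proof. exact: linearNr. Qed.

Lemma dotZl a x z : dot (a *: x) z = a * dot x z.
Proof. exact: linearZl_LR. Qed.

Lemma dotZr a x z : dot z (a *: x) = a * dot z x.
Proof. exact: linearZr_LR. Qed.

Lemma dot0l z : dot 0 z = 0.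
Proof. exact: linear0l. Qed.

Definition dotE := (dotDl, dotDr, dotNl, dotNr, dotZl, dotZr).

End Dot.

(** * Maximally monotone operators *)

Section MaximallyMonotone.
Context (R : realType) (X : lmodType R) (dot : {dot X for idfun}).
Variable A : X -> set X.
Hypothesis maxA : maximally_monotone dot A.

(** The form in which maximality is used: otherwise adjoining the pair (x, u)
    to A gives a proper monotone extension. *)
Lemma maximally_monotone_mem x u :
  (forall y v, A y v -> 0 <= dot (x - y) (u - v)) -> A x u.
Proof.
move=> xu; have [monA] := maxA.
pose A' y := A y `|` [set v | y = x /\ v = u].
move=> /(_ A'); apply; [|by move=> y v; left|by right].
move=> y1 y2 v1 v2 [Av1|[-> ->]] [Av2|[-> ->]].
- exact: monA.
- by rewrite -[y1 - _]opprB -[v1 - _]opprB dotNl dotNr opprK; apply: xu.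
- exact: xu.
- by rewrite !subrr dot0l.
Qed.

Lemma maximally_monotone_nonempty : exists y v, A y v.
Proof.
have [//|noA] := pselect (exists y v, A y v).
exists 0, 0; apply: maximally_monotone_mem => y v Ayv.
by case: noA; exists y, v.
Qed.

End MaximallyMonotone.

(** * Quadratic estimates in a Hilbert space *)

Section Quadratic.
Context (R : realType) (X : completeNormedModType R).
Context (dot : {dot X for idfun}) (hdot : norm_from_dot dot).
Implicit Types (x y z : X) (s : R).

(** The defect s (1 - s) |y - x|^2 is what makes |. - z|^2 strongly convex. *)
Lemma sqr_norm_conv s x y z :
  `|x + s *: (y - x) - z| ^+ 2 =
  (1 - s) * `|x - z| ^+ 2 + s * `|y - z| ^+ 2 - s * (1 - s) * `|y - x| ^+ 2.
Proof.
rewrite !hdot !dotE (dotC dot y x) (dotC dot z x) (dotC dot z y); ring.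
Qed.

(** For a strongly convex function, a minimising sequence whose n-th value
    exceeds the infimum by at most 1/(n+1) satisfies this bound. *)
Lemma sqr_cauchy_cvg (f : nat -> X) :
  (forall n k, `|f n - f k| ^+ 2 <= 2 * (n.+1%:R^-1 + k.+1%:R^-1)) ->
  cvg (f @ \oo).
Proof.
move=> fC; apply/cauchy_cvgP/cauchy_ballP => e e0; rewrite near_simpl.
have d0 : 0 < e ^+ 2 / 4 by rewrite divr_gt0 ?exprn_gt0.
near=> p; rewrite -ball_normE /ball_/=.
rewrite -(ltr_pXn2r (n := 2)) ?nnegrE ?(ltW e0)//.
apply: le_lt_trans (fC _ _) _.
have : p.1.+1%:R^-1 < e ^+ 2 / 4.
  near: p; exact: (cvg_fst (near_infty_natSinv_lt (PosNum d0))).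
have : p.2.+1%:R^-1 < e ^+ 2 / 4.
  near: p; exact: (cvg_snd (near_infty_natSinv_lt (PosNum d0))).
move=> p2 p1; apply: (lt_le_trans (y := 2 * (e ^+ 2 / 4 + e ^+ 2 / 4))).
  by rewrite ltr_pM2l ?ltrD.
by rewrite le_eqVlt; apply/orP; left; apply/eqP; field.
Unshelve. all: by end_near.
Qed.

End Quadratic.

(** * Minty's theorem *)

Section Minty.
Context (R : realType) (X : completeNormedModType R).
Context (dot : {dot X for idfun}) (hdot : norm_from_dot dot).
Variables (A : X -> set X) (b : X).
Implicit Types (x y v w : X) (c m s : R).

(** [gap_le x w c] says that G (x, w) <= c, for
    G (x, w) = |x + w - b|^2 + 2 (F_A (x, w) - <x, w>) with F_A the Fitzpatrick
    function of A. Bounding the supremum termwise avoids infinite values, and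
    writing each term with squared norms, as [gap_termE] permits, shows at once
    that G is continuous termwise and strongly convex. *)
Definition gap_le x w c := forall y v, A y v ->
  `|x - (b - v)| ^+ 2 + `|w - (b - y)| ^+ 2 - `|y + v - b| ^+ 2 <= c.

Lemma gap_termE x w y v :
  `|x - (b - v)| ^+ 2 + `|w - (b - y)| ^+ 2 - `|y + v - b| ^+ 2 =
  `|x + w - b| ^+ 2 - 2 * dot (x - y) (w - v).
Proof.
rewrite !hdot !dotE (dotC dot w x) (dotC dot v x) (dotC dot b x).
rewrite (dotC dot y w) (dotC dot b w) (dotC dot v y).
rewrite (dotC dot b y) (dotC dot b v); ring.
Qed.

Lemma gap_le_graph x w : Defs.monotone dot A -> A x w ->
  gap_le x w (`|x + w - b| ^+ 2).
Proof.
move=> monA Axw y v Ayv; rewrite gap_termE gerBl mulr_ge0//; exact: monA.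
Qed.

(** If G (x, w) < |x + w - b|^2, every term has <x - y, w - v> > 0, so (x, w) is
    in the graph by maximality; but its own term is exactly |x + w - b|^2. *)
Lemma gap_le_ge x w c : maximally_monotone dot A -> gap_le x w c ->
  `|x + w - b| ^+ 2 <= c.
Proof.
move=> maxA gapc; rewrite leNgt; apply/negP => ltc.
have Axw : A x w.
  apply: (maximally_monotone_mem maxA) => y v /gapc; rewrite gap_termE.
  lra.
by have := gapc _ _ Axw; rewrite gap_termE subrr dot0l; lra.
Qed.

Lemma gap_le_conv s x w c x' w' c' : 0 <= s <= 1 ->
  gap_le x w c -> gap_le x' w' c' ->
  gap_le (x + s *: (x' - x)) (w + s *: (w' - w))
    ((1 - s) * c + s * c'
     - s * (1 - s) * (`|x' - x| ^+ 2 + `|w' - w| ^+ 2)).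
Proof.
move=> /andP[s0 s1] gapc gapc' y v Ayv; rewrite !(sqr_norm_conv hdot).
have := ler_wpM2l s0 (gapc' _ _ Ayv).
have : 0 <= 1 - s by rewrite subr_ge0.
move/ler_wpM2l => /(_ _ _ (gapc _ _ Ayv)).
lra.
Qed.

(** By strong convexity, near-minimisers are close together: comparing two of
    them with their midpoint shows that a minimising sequence is Cauchy. *)
Lemma gap_minimizer : maximally_monotone dot A ->
  exists x w m, gap_le x w m /\
    forall x' w' c, gap_le x' w' c -> m <= c.
Proof.
move=> maxA; pose E := [set c | exists x w, gap_le x w c].
have lbE : lbound E 0.
  move=> c [x [w /(gap_le_ge maxA)]]; apply: le_trans.
  exact: exprn_ge0.
have infE : has_inf E.
  split; last by exists 0.
  have [y [v Ayv]] := maximally_monotone_nonempty maxA.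
  by exists (`|y + v - b| ^+ 2), y, v; apply: gap_le_graph => //; case: maxA.
set m := inf E.
have mE x w c : gap_le x w c -> m <= c.
  by move=> gapc; apply: ge_inf; [exists 0|exists x, w].
have /choice[p pP] (n : nat) :
    exists p : X * X, gap_le p.1 p.2 (m + n.+1%:R^-1).
  have n0 : (0 : R) < n.+1%:R^-1 by rewrite invr_gt0.
  have [c [x [w gapc]] cm] := inf_adherent n0 infE.
  by exists (x, w) => y v /gapc/le_trans; apply; apply: ltW.
have pC n k : `|(p n).1 - (p k).1| ^+ 2 + `|(p n).2 - (p k).2| ^+ 2
    <= 2 * (n.+1%:R^-1 + k.+1%:R^-1).
  have h : 0 <= (2^-1 : R) <= 1 by apply/andP; split; lra.
  have := mE _ _ _ (gap_le_conv h (pP k) (pP n)).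
  by move: (k.+1%:R^-1) (n.+1%:R^-1) => r1 r2 {h}; lra.
have c1 : cvg ((fst \o p) n @[n --> \oo]).
  apply: sqr_cauchy_cvg => n k; apply: le_trans (pC n k).
  by rewrite lerDl exprn_ge0.
have c2 : cvg ((snd \o p) n @[n --> \oo]).
  apply: sqr_cauchy_cvg => n k; apply: le_trans (pC n k).
  by rewrite lerDr exprn_ge0.
exists (lim ((fst \o p) n @[n --> \oo])), (lim ((snd \o p) n @[n --> \oo])), m.
split=> // y v Ayv.
have cm : (m + n.+1%:R^-1) @[n --> \oo] --> m.
  rewrite -[X in _ --> X]addr0; apply: cvgD; first exact: cvg_cst.
  exact: cvg_harmonic.
have sqn (f : nat -> X) z : cvg (f n @[n --> \oo]) ->
    `|f n - z| ^+ 2 @[n --> \oo] --> `|lim (f n @[n --> \oo]) - z| ^+ 2.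
  move=> cf; under eq_fun do rewrite expr2.
  by rewrite expr2; apply: cvgM; apply: cvg_norm; apply: cvgB => //;
    apply: cvg_cst.
apply: (ler_cvg_to
  (cvgB (cvgD (sqn _ (b - v) c1) (sqn _ (b - y) c2)) (cvg_cst _)) cm).
by near=> n; apply: pP.
Unshelve. all: by end_near.
Qed.

(** Along the segment from the minimiser, strong convexity gives
    (1 - s) (|x' - x|^2 + |w' - w|^2) <= c - m for 0 < s <= 1; the claim is the
    limit of this as s tends to 0. *)
Lemma gap_growth x w m :
  gap_le x w m -> (forall x' w' c, gap_le x' w' c -> m <= c) ->
  forall x' w' c, gap_le x' w' c -> m + (`|x' - x| ^+ 2 + `|w' - w| ^+ 2) <= c.
Proof.
move=> gapm minm x' w' c gapc; rewrite leNgt; apply/negP.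
set D := (X in m + X) => ltc.
have mc := minm _ _ _ gapc.
pose d := m + D - c.
have d0 : 0 < d by rewrite /d; lra.
have D0 : 0 < D by lra.
(* Any s with 0 < s <= 1 and s * D < d contradicts minimality. *)
pose s := d / (2 * D).
have sD : s * D = d / 2 by rewrite /s; field; rewrite gt_eqF.
have s0 : 0 < s by rewrite divr_gt0// mulr_gt0.
have s1 : s <= 1 by rewrite ler_pdivrMr ?mulr_gt0// /d; lra.
have h : 0 <= s <= 1 by rewrite (ltW s0).
have := minm _ _ _ (gap_le_conv h gapm gapc); rewrite -/D.
have -> : (1 - s) * m + s * c - s * (1 - s) * D = m + s * (s * D - d).
  by rewrite /d; ring.
rewrite lerDl//; apply/negP; rewrite -ltNge pmulr_rlt0// sD; lra.
Qed.

(** At the minimiser (x, w), quadratic growth bounds |y - x|^2 + |v - w|^2 by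
    |y + v - b|^2 - |x + w - b|^2 for (y, v) in the graph. The difference
    |y - x|^2 + |v - w|^2 - |y + v - b|^2 is the term of G at (b - w, b - x), so
    the bound implies that (b - w, b - x) is monotonically related to (y, v). *)
Theorem minty_surjective : maximally_monotone dot A -> exists z, A z (b - z).
Proof.
move=> maxA; have [monA _] := maxA.
have [x [w [m [gapm /(gap_growth gapm) growth]]]] := gap_minimizer maxA.
have em := gap_le_ge maxA gapm.
have grow y v : A y v -> `|x + w - b| ^+ 2 + (`|y - x| ^+ 2 + `|v - w| ^+ 2)
    <= `|y + v - b| ^+ 2.
  move=> Ayv; apply: le_trans (growth _ _ _ (gap_le_graph monA Ayv)).
  by rewrite lerD2r.
have sumE : b - w + (b - x) - b = - (x + w - b).
  by rewrite -addrA [b - x - b]addrAC subrr add0r opprB opprD addrA addrAC.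
have Aw : A (b - w) (b - x).
  apply: (maximally_monotone_mem maxA) => y v /grow.
  have := gap_termE (b - w) (b - x) y v.
  have sub_refl p q : b - p - (b - q) = q - p.
    by rewrite opprB addrC subrKA.
  rewrite !sub_refl sumE normrN.
  have := exprn_ge0 2 (normr_ge0 (x + w - b)); lra.
(* The growth inequality at (b - w, b - x) itself forces b - w = x. *)
exists x; suff bw : b - w = x by rewrite -{1}bw.
apply/eqP; rewrite -subr_eq0 -normr_eq0 -sqrf_eq0 eq_le exprn_ge0// andbT.
have := grow _ _ Aw; rewrite sumE normrN.
have := exprn_ge0 2 (normr_ge0 (b - x - w)); lra.
Qed.

Lemma resolvent_in : maximally_monotone dot A ->
  A (resolvent A b) (b - resolvent A b).
Proof.
move=> maxA; have [z Az] := minty_surjective maxA.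
have : op_inverse (id_plus A) b z by exists (b - z) => //; rewrite addrC subrK.
move=> /(xgetI 0) [u Au bE]; suff -> : b - resolvent A b = u by [].
by rewrite -{1}bE addrC addKr.
Qed.

End Minty.

(** * Resolvents and fixed points of the Douglas-Rachford operator *)

Section DouglasRachford.
Context (R : realType) (X : completeNormedModType R).
Context (dot : {dot X for idfun}) (hdot : norm_from_dot dot).
Implicit Types (A B : X -> set X) (x z k : X).

Lemma resolvent_graph A z k : maximally_monotone dot A -> A z k ->
  resolvent A (z + k) = z.
Proof.
move=> maxA Azk; have Aj := resolvent_in hdot (z + k) maxA.
have [monA _] := maxA; have := monA _ _ _ _ Aj Azk.
set j := resolvent A _.
have -> : z + k - j - k = - (j - z) by rewrite opprB addrAC addrK.
rewrite dotNr -hdot oppr_ge0 => jz.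
apply/eqP; rewrite -subr_eq0 -normr_eq0 -sqrf_eq0 eq_le jz.
by rewrite exprn_ge0.
Qed.

Lemma reflected_resolvent_graph A z k : maximally_monotone dot A -> A z k ->
  reflected_resolvent A (z + k) = z - k.
Proof.
move=> maxA Azk; rewrite /reflected_resolvent resolvent_graph//.
by rewrite scaler_nat mulr2n opprD addrACA subrr add0r.
Qed.

Lemma Fix_DR A B x : Fix (DR_operator A B) x <->
  reflected_resolvent B (reflected_resolvent A x) = x.
Proof.
rewrite /Fix /DR_operator /=; set y := reflected_resolvent B _; split=> [xE|yE].
  have : 2%:R *: x = x + y by rewrite {1}xE scalerA mulfV ?pnatr_eq0// scale1r.
  by rewrite scaler_nat mulr2n => /addrI.
rewrite yE -mulr2n -[x *+ 2](scaler_nat 2) scalerA.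
by rewrite mulVf ?pnatr_eq0// scale1r.
Qed.

Lemma ext_solutions_sym A B zk :
  ext_solutions A B zk -> ext_solutions B A (zk.1, - zk.2).
Proof. by case=> Bz Az; split; rewrite //= opprK. Qed.

(** Monotonicity of A and of B bound the same inner product from both sides. *)
Lemma ext_solutions_orthogonal A B z k z' k' :
  Defs.monotone dot A -> Defs.monotone dot B ->
  ext_solutions A B (z, k) -> ext_solutions A B (z', k') ->
  dot (z - z') (k - k') = 0.
Proof.
move=> monA monB [/= Bz Az] [/= Bz' Az'].
apply/eqP; rewrite eq_le (monA _ _ _ _ Az Az') andbT.
have := monB _ _ _ _ Bz Bz'.
by rewrite -opprD dotNr oppr_ge0.
Qed.

(** Read backwards: with z = J_A x and y = R_A x, the equation R_B y = x says
    2 J_B y = x + y = 2 z, so J_B y = z and y - z = -(x - z) lies in B z. *)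
Lemma Fix_DR_solution A B x :
  maximally_monotone dot A -> maximally_monotone dot B ->
  Fix (DR_operator A B) x ->
  ext_solutions A B (resolvent A x, x - resolvent A x).
Proof.
move=> maxA maxB /Fix_DR Fx; have Ax := resolvent_in hdot x maxA; split=> //=.
set z := resolvent A x; set y := reflected_resolvent A x in Fx.
have yE : y = z - (x - z).
  by rewrite /y /reflected_resolvent scaler_nat mulr2n opprB addrA.
have := resolvent_in hdot y maxB.
suff -> : resolvent B y = z by rewrite {1}yE addrAC subrr add0r.
apply: (scalerI (a := 2%:R : R)); first by rewrite pnatr_eq0.
have -> : 2%:R *: resolvent B y = x + y by rewrite -{1}Fx subrK.
by rewrite yE opprB addrCA [x + _]addrC subrK scaler_nat mulr2n.
Qed.

Lemma reflected_resolvent_isometric A B :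
  maximally_monotone dot A -> maximally_monotone dot B ->
  isometric_on (Fix (DR_operator A B)) (reflected_resolvent A).
Proof.
move=> maxA maxB.
have solution x : Fix (DR_operator A B) x ->
    exists z k, ext_solutions A B (z, k) /\ x = z + k.
  move=> /(Fix_DR_solution maxA maxB) Sx.
  exists (resolvent A x), (x - resolvent A x); split=> //.
  by rewrite addrC subrK.
move=> x y /set_mem/solution[z [k [Szk ->]]].
move=> /set_mem/solution[z' [k' [Szk' ->]]].
have [[monA _] [monB _]] := (maxA, maxB).
have zk := ext_solutions_orthogonal monA monB Szk Szk'.
have [[_ /= Az] [_ /= Az']] := (Szk, Szk').
rewrite !(reflected_resolvent_graph maxA)// [in RHS]opprD [in RHS]addrACA.
have -> : z - k - (z' - k') = (z - z') - (k - k').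
  by rewrite opprD addrACA -opprD.
apply/eqP; rewrite -(eqrXn2 (n := 2)) ?normr_ge0//; apply/eqP.
move: (z - z') (k - k') zk => p q pq.
by rewrite !hdot !dotE [dot q p]dotC pq; ring.
Qed.

(** * The commutative diagram *)

Section Diagram.
Variables (A B : X -> set X).
Hypotheses (maxA : maximally_monotone dot A) (maxB : maximally_monotone dot B).

(** The common parametrisation of the four vertices by S_(A,B). *)
Definition vertex_point (v : vertex) : X * X -> ambient X v :=
  match v return X * X -> ambient X v with
  | FixAB => fun zk => zk.1 + zk.2
  | FixBA => fun zk => zk.1 - zk.2
  | SolAB => fun zk => zk
  | SolBA => fun zk => (zk.1, - zk.2)
  end.

Lemma arrow_vertex_point u v (a : arrow u v) zk : ext_solutions A B zk ->
  arrow_map A B a (vertex_point u zk) = vertex_point v zk.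
Proof.
case: zk => z k [/= Bz Az]; case: a => /=.
- exact: reflected_resolvent_graph.
- by rewrite (reflected_resolvent_graph maxB)// opprK.
- by [].
- by rewrite opprK.
- by rewrite (resolvent_graph maxA)// addrAC subrr add0r.
- by [].
- by rewrite (resolvent_graph maxB)// addrAC subrr add0r.
- by [].
Qed.

(** The end point depends on (z, k) and v only, and not on p, which is why the
    diagram commutes. *)
Lemma dpath_vertex_point u v (p : dpath u v) zk : ext_solutions A B zk ->
  dpath_map A B p (vertex_point u zk) = vertex_point v zk.
Proof.
by move=> Szk; elim: p => //= {}u w {}v a q IHq; rewrite arrow_vertex_point.
Qed.

(** At the fixed-point vertices this is the round trip R_A, R_B (or R_B, R_A)
    on the points of (z, k). *)
Lemma vertex_point_in v zk : ext_solutions A B zk ->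
  vertex_set A B (vertex_point v zk).
Proof.
move=> Szk.
have /= RA := arrow_vertex_point arrow_RA Szk.
have /= RB := arrow_vertex_point arrow_RB Szk.
case: v => /=.
- by apply/Fix_DR; rewrite RA RB.
- by apply/Fix_DR; rewrite RB RA.
- exact: Szk.
- exact: ext_solutions_sym.
Qed.

Lemma vertex_point_surj v (x : ambient X v) : vertex_set A B x ->
  exists2 zk, ext_solutions A B zk & vertex_point v zk = x.
Proof.
case: v x => x /= Vx.
- exists (resolvent A x, x - resolvent A x); first exact: Fix_DR_solution.
  by rewrite /= addrC subrK.
- have Sx := ext_solutions_sym (Fix_DR_solution maxB maxA Vx).
  by eexists; [exact: Sx|rewrite /= opprK addrC subrK].
- by exists x.
- exists (x.1, - x.2); first exact: ext_solutions_sym.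
  by case: x {Vx} => z w; rewrite /= opprK.
Qed.

Lemma DR_diagram_well_defined : diagram_well_defined A B.
Proof.
move=> u v a x /vertex_point_surj[zk Szk <-].
by rewrite /= arrow_vertex_point//; apply: vertex_point_in.
Qed.

Lemma DR_diagram_commutes : diagram_commutes A B.
Proof.
move=> u v p q x /vertex_point_surj[zk Szk <-].
by rewrite !dpath_vertex_point.
Qed.

End Diagram.

End DouglasRachford.

Theorem theorem2p1 (R : realType) (X : completeNormedModType R)
    (dot : {dot X for idfun}) (hdot : norm_from_dot dot)
    (A B : X -> set X)
    (hA : maximally_monotone dot A) (hB : maximally_monotone dot B) :
  let RA := reflected_resolvent A in
  let RB := reflected_resolvent B in
  let FAB := Fix (DR_operator A B) in
  let FBA := Fix (DR_operator B A) in
  [/\ [/\ set_bij FAB FBA RA & isometric_on FAB RA],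
      [/\ set_bij FBA FAB RB, isometric_on FBA RB,
          {in FAB, cancel RA RB} & {in FBA, cancel RB RA}],
      diagram_well_defined A B /\ diagram_commutes A B
    & (forall x : X, FAB x ->
         exists z k : X, ext_solutions A B (z, k) /\ x = z + k) /\
      (forall z k : X, ext_solutions A B (z, k) ->
         FAB (z + k) /\ RA (z + k) = z - k)].
Proof.
move=> RA RB FAB FBA.
have RA_fun : set_fun FAB FBA RA.
  exact: (DR_diagram_well_defined hdot hA hB arrow_RA).
have RB_fun : set_fun FBA FAB RB.
  exact: (DR_diagram_well_defined hdot hA hB arrow_RB).
have comm := DR_diagram_commutes hdot hA hB.
have RAK x : FAB x -> RB (RA x) = x.
  exact: (comm _ _ (dpath_cons arrow_RA (dpath_cons arrow_RB (dpath_nil _)))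
    (dpath_nil _)).
have RBK x : FBA x -> RA (RB x) = x.
  exact: (comm _ _ (dpath_cons arrow_RB (dpath_cons arrow_RA (dpath_nil _)))
    (dpath_nil _)).
have inj (F : set X) (f g : X -> X) : (forall x, F x -> g (f x) = x) ->
    set_inj F f.
  by move=> fK x y /set_mem Fx /set_mem Fy fxy; rewrite -(fK x)// fxy fK.
split; [split|split| |split].
- split=> //; first exact: inj RAK.
  by move=> y Fy; exists (RB y); [exact: RB_fun|exact: RBK].
- exact: (reflected_resolvent_isometric hdot hA hB).
- split=> //; first exact: inj RBK.
  by move=> y Fy; exists (RA y); [exact: RA_fun|exact: RAK].
- exact: (reflected_resolvent_isometric hdot hB hA).
- by move=> x /set_mem; apply: RAK.
- by move=> x /set_mem; apply: RBK.
- by split; [exact: DR_diagram_well_defined|].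
- move=> x /(vertex_point_surj hdot hA hB (v := FixAB))[[z k] Szk <-].
  by exists z, k.
- move=> z k Szk; split; first exact: (vertex_point_in hdot hA hB FixAB Szk).
  exact: (arrow_vertex_point hdot hA hB arrow_RA Szk).
Qed.
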